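(* Let $R$ be an integral domain and let $K$ be its field of fractions. Then $R$ is a D-ring if and only if the following holds: for all polynomials $f(x),g(x)\in R[x]$ such that for every $k\in R$ ($g(k)\neq 0$ implies $g(k)\mid f(k)$ in $R$), either $f(x)=0$ or $\deg g\leq \deg f$.
   Context: All rings are commutative with identity. An integral domain $R$ with field of fractions $K$ is called a D-ring if, for all polynomials $f(x),g(x)\in R[x]$ with $g(x)\neq 0$ such that $g(k)\mid f(k)$ in $R$ for almost all $k\in R$ (i.e. for all but finitely many $k\in R$), one has $\frac{f(x)}{g(x)}\in K[x]$, i.e. $g(x)$ divides $f(x)$ in $K[x]$. The degree of the zero polynomial is taken to be $-\infty$. *)

(* Defs.v *)
From HB Require Import structures.
From mathcomp Require Import all_boot all_order all_algebra.

Set Implicit Arguments.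
Unset Strict Implicit.
Unset Printing Implicit Defensive.

Import GRing.Theory.
Local Open Scope ring_scope.

(* a | b in R; in particular 0 divides only 0. *)
Definition ring_dvd (R : idomainType) (a b : R) : Prop :=
  exists c : R, b = a * c.

(* The list [s] contains all the exceptions, whose set is therefore finite. *)
Definition almost_all (R : idomainType) (P : R -> Prop) : Prop :=
  exists s : seq R, forall k : R, k \notin s -> P k.

Definition to_frac_poly (R : idomainType) (p : {poly R}) : {poly {fraction R}} :=
  map_poly (@FracField.tofrac R) p.

Definition D_ring (R : idomainType) : Prop :=
  forall f g : {poly R},
    g != 0 ->
    almost_all (fun k : R => ring_dvd g.[k] f.[k]) ->
    to_frac_poly g %| to_frac_poly f.

(* Main.v *)
Require Import Defs.
From HB Require Import structures.
From mathcomp Require Import all_boot all_order all_algebra.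

Set Implicit Arguments.
Unset Strict Implicit.
Unset Printing Implicit Defensive.

Import GRing.Theory.
Local Open Scope ring_scope.

(* If g(k) | f(k) for almost all k, then the same holds for the remainder r of
   the pseudo-division of f by g. With h the product of X - a over the exceptional
   points a, g(k)^n divides h(k) r(k)^n for every k. Since deg r < deg g, for
   n > deg h the degree of h r^n is less than that of g^n, which forces r = 0. *)

Lemma ring_dvdX (R : idomainType) (a b : R) n :
  ring_dvd a b -> ring_dvd (a ^+ n) (b ^+ n).
Proof. by case=> c ->; exists (c ^+ n); rewrite exprMn. Qed.

Lemma size_to_frac_poly (R : idomainType) (p : {poly R}) :
  size (to_frac_poly p) = size p.
Proof.
apply: size_map_inj_poly; last exact: rmorph0.
by move=> x y /eqP; rewrite tofrac_eq => /eqP.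
Qed.

(** Over [R], [g %| f] only gives [c *: f = q * g] with [c] nonzero; this [c] becomes a unit in the
    fraction field. *)
Lemma dvdp_to_frac_poly (R : idomainType) (f g : {poly R}) :
  g %| f -> to_frac_poly g %| to_frac_poly f.
Proof.
case/Pdiv.Idomain.dvdpP=> -[c q] /= c0 E.
rewrite -(@dvdpZr _ (FracField.tofrac c)); last by rewrite tofrac_eq0.
by rewrite /to_frac_poly -map_polyZ E rmorphM dvdp_mull.
Qed.

(** By pseudo-division, the remainder is a multiple of [f] minus a multiple of [g]; evaluate at
    [k]. *)
Lemma ring_dvd_modp (R : idomainType) (f g : {poly R}) (k : R) :
  ring_dvd g.[k] f.[k] -> ring_dvd g.[k] (f %% g).[k].
Proof.
case=> c Hc; have /(congr1 (horner^~ k)) := Pdiv.Idomain.divp_eq f g.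
rewrite hornerZ hornerD hornerM Hc => E.
exists (lead_coef g ^+ scalp f g * c - (f %/ g).[k]).
by rewrite mulrBr mulrCA E [g.[k] * _]mulrC addrAC subrr add0r.
Qed.

(* Stated with a double negation because a root of g cannot be searched for in
   an arbitrary R without classical axioms. *)
Lemma almost_all_neq0 (R : idomainType) (g : {poly R}) :
  g != 0 -> classically (almost_all (fun k => g.[k] != 0)).
Proof.
have [n] := ubnP (size g); elim: n g => // n IHn g /ltnSE szg g0 b gb.
(* A root [a] is factored out and joins the exceptions of the cofactor. *)
apply: (classic_EM (P := exists a, root g a)) => -[[a /factor_theorem[q Eg]]|noroot].
  have q0 : q != 0 by apply: contraNneq g0 => q0; rewrite Eg q0 mul0r.
  apply: (IHn q _ q0) => [|[s qs]].
    by rewrite (leq_trans _ szg) // Eg size_Mmonic ?monicXsubC // size_XsubC addn2.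
  apply: gb; exists (a :: s) => k; rewrite inE negb_or => /andP[ka ks].
  by rewrite Eg hornerM hornerXsubC mulf_neq0 ?subr_eq0 // qs.
by apply: gb; exists [::] => k _; apply/negP => gk; apply: noroot; exists k.
Qed.

(* [size p] is [deg p + 1], and 0 for p = 0, so that comparing sizes is
   comparing degrees under the convention that deg 0 is -oo. *)
Theorem proposition2p1 (R : idomainType) :
  D_ring R <->
  (forall f g : {poly R},
     (forall k : R, g.[k] != 0 -> ring_dvd g.[k] f.[k]) ->
     f = 0 \/ (size g <= size f)%N).
Proof.
split=> [DR f g gf | H f g g0 [s gf]].
  have [->|g0] := eqVneq g 0; first by right; rewrite size_poly0.
  have [->|f0] := eqVneq f 0; [by left | right].
  (* The goal is boolean, so the double negation can be removed. *)
  apply: (almost_all_neq0 g0) => -[s gs].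
  have dvd_gf : to_frac_poly g %| to_frac_poly f.
    by apply: DR => //; exists s => k ks; apply/gf/gs.
  rewrite -(size_to_frac_poly f) -(size_to_frac_poly g) dvdp_leq //.
  by rewrite -size_poly_eq0 size_to_frac_poly size_poly_eq0.
apply/dvdp_to_frac_poly/eqP; have [//|r0] := eqVneq (f %% g) 0; exfalso.
set r := f %% g in r0.
pose h := \prod_(a <- s) ('X - a%:P).
pose n := (size s).+1.
have h0 : h != 0 by rewrite monic_neq0 // monic_prod_XsubC.
have [k _|/eqP|] := H (h * r ^+ n) (g ^+ n).
- rewrite hornerM !horner_exp; have [ks|ks] := boolP (k \in s).
    (* At an exception [h] vanishes, and everything divides 0. *)
    have /rootP -> : root h k by rewrite root_prod_XsubC.
    by exists 0; rewrite mul0r mulr0.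
  have [c ->] := ring_dvdX n (ring_dvd_modp (gf k ks)).
  by exists (h.[k] * c); rewrite mulrCA.
- by rewrite mulf_eq0 expf_eq0 (negPf h0) (negPf r0) andbF.
have szX (p : {poly R}) : p != 0 -> size (p ^+ n) = ((size p).-1 * n).+1.
  by move=> p0; rewrite -size_exp prednK // size_poly_gt0 expf_neq0.
rewrite size_mul ?expf_neq0 // size_prod_XsubC !szX //= addnS /= leqNgt ltnS.
apply/negP; rewrite negbK.
have r_gt0 : (0 < size r)%N by rewrite size_poly_gt0.
have lt_rg : (size r < size g)%N by rewrite Pdiv.Idomain.ltn_modp.
(* Since [n] is deg h + 1, the left side is n (deg r + 1), and deg r + 1 is at most deg g. *)
rewrite -addSn -mulSn prednK // leq_mul2r -ltnS prednK //.
exact: leq_ltn_trans lt_rg.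
Qed.
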